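(* Let $A$ and $B$ be two strongly Morita equivalent locally $C^*$-algebras, let $E$ be a Hilbert $A$-module which gives the strong Morita equivalence between $A$ and $B$ (that is, $E$ is a full Hilbert $A$-module together with an isomorphism of locally $C^*$-algebras $\Psi:B\to K_A(E)$), and let $\widetilde E=K_A(E,A)$, regarded as a Hilbert $B$-module on which $A$ acts. Let $(\varphi,H)$ be a non-degenerate representation of $A$. Then $(\varphi,H)$ is unitarily equivalent to $\left({}_{\widetilde E}^{A}({}_E^B\varphi),\,{}_{\widetilde E}({}_EH)\right)$, the representation of $A$ obtained by inducing $\varphi$ from $A$ to $B$ via $E$ and then inducing the result from $B$ to $A$ via $\widetilde E$.
   Context: Locally $C^*$-algebras. A locally $C^*$-algebra is a complete Hausdorff complex topological $*$-algebra $A$ whose topology is determined by its continuous $C^*$-seminorms: a net $\{a_i\}$ converges to $0$ iff $\{p(a_i)\}$ converges to $0$ for every continuous $C^*$-seminorm $p$ on $A$. $S(A)$ denotes the set of all continuous $C^*$-seminorms on $A$. An isomorphism of locally $C^*$-algebras is a bijective continuous $*$-morphism with continuous inverse. Representations. A representation $(\varphi,H)$ of $A$ is a continuous $*$-morphism $\varphi:A\to L(H)$, with $L(H)$ the $C^*$-algebra of bounded linear operators on a Hilbert space $H$. It is non-degenerate if $\varphi(A)H$ is dense in $H$. Two representations $(\varphi_1,H_1)$, $(\varphi_2,H_2)$ of $A$ are unitarily equivalent if there is a unitary operator $U$ from $H_1$ onto $H_2$ with $U\varphi_1(a)=\varphi_2(a)U$ for all $a\in A$. Hilbert modules. A pre-Hilbert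 $A$-module is a complex vector space $E$ which is a right $A$-module (compatibly with the complex algebra structure) with an $A$-valued inner product $\langle\cdot,\cdot\rangle:E\times E\to A$, $\mathbb{C}$- and $A$-linear in the second variable, such that $\langle\xi,\eta\rangle^*=\langle\eta,\xi\rangle$, $\langle\xi,\xi\rangle\ge 0$, and $\langle\xi,\xi\rangle=0$ iff $\xi=0$. It is a Hilbert $A$-module if it is complete for the topology given by the seminorms $\|\xi\|_p=\sqrt{p(\langle\xi,\xi\rangle)}$, $p\in S(A)$. It is full if the ideal of $A$ generated by $\{\langle\xi,\eta\rangle:\xi,\eta\in E\}$ is dense in $A$. For Hilbert $A$-modules $E,F$, $L_A(E,F)$ is the space of adjointable linear operators from $E$ to $F$ with topology given by the seminorms $\widetilde p(T)=\sup\{\|T\xi\|_p:\|\xi\|_p\le 1\}$, $p\in S(A)$; $L_A(E)=L_A(E,E)$ is a locally $C^*$-algebra. $K_A(E,F)$ is the closed linear span in $L_A(E,F)$ of the operators $\theta_{\eta,\xi}$, $\theta_{\eta,\xi}(\zeta)=\eta\langle\xi,\zeta\rangle$ ($\xi\in E$, $\eta\in F$), and $K_A(E)=K_A(E,E)$, a locally $C^*$-algebra. A continuous $*$-morphism $\Phi:A\to L_B(E)$, with $E$ a Hilbert $B$-module, is non-degenerate if $\Phi(A)E$ is dense in $E$; one then says $A$ acts non-degenerately on $E$. Induced representation. Let $\Phi:A\to L_B(E)$ be a non-degenerate continuous $*$-morphism ($A,B$ arbitrary locally $C^*$-algebras, $E$ a Hilbert $B$-module) and $(\varphi,H)$ a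 non-degenerate representation of $B$. On $E\otimes_{\mathrm{alg}}H$ consider the positive semidefinite sesquilinear form determined by $\langle\xi\otimes h_1,\eta\otimes h_2\rangle_0^{\varphi}=\langle h_1,\varphi(\langle\xi,\eta\rangle_E)h_2\rangle$ (inner products are linear in the second variable). ${}_EH$ is the Hilbert space completion of the quotient of $E\otimes_{\mathrm{alg}}H$ by the subspace of vectors of zero length for this form. For $T\in L_B(E)$, the map $\xi\otimes h\mapsto T\xi\otimes h$ induces a bounded operator ${}_E\varphi(T)$ on ${}_EH$. The (Rieffel-)induced representation from $B$ to $A$ via $E$ is the non-degenerate representation $({}_E^A\varphi,{}_EH)$ of $A$, where ${}_E^A\varphi={}_E\varphi\circ\Phi$. Strong Morita equivalence. $A$ and $B$ are strongly Morita equivalent, $A\sim_M B$, if there is a full Hilbert $A$-module $E$ such that the locally $C^*$-algebras $B$ and $K_A(E)$ are isomorphic; such an $E$, with an isomorphism $\Psi:B\to K_A(E)$, is said to give the equivalence. Then $B$ acts non-degenerately on $E$ through $\Psi:B\to K_A(E)\subseteq L_A(E)$; this action is used to form ${}_E^B\varphi$. The space $\widetilde E=K_A(E,A)$ is a full Hilbert $K_A(E)$-module with right action $T\cdot S=T\circ S$ ($T\in K_A(E,A)$, $S\in K_A(E)$) and inner product $\langle T,S\rangle=T^*\circ S$; through $\Psi$ it is regarded as a Hilbert $B$-module (action $T\cdot b=T\circ\Psi(b)$, inner product $\Psi^{-1}(T^*\circ S)$). The algebra $A$ acts non-degenerately on $\widetilde E$ through the isomorphism of locally $C^*$-algebras $\alpha:A\to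 K_{K_A(E)}(\widetilde E)$ determined by $\alpha(a)(\theta_{b,\xi})=\theta_{ab,\xi}$ ($a,b\in A$, $\xi\in E$); this action is used to form the induction from $B$ to $A$ via $\widetilde E$. *)

(* Defs.v *)
From HB Require Import structures.
From mathcomp Require Import all_boot all_order all_algebra.
From mathcomp Require Import generic_quotient ring_quotient.
From mathcomp Require Import all_classical reals ereal topology normedtype.
From mathcomp Require Import complex.
From mathcomp Require Import freeg.

Set Implicit Arguments.
Unset Strict Implicit.
Unset Printing Implicit Defensive.

Import Order.TTheory GRing.Theory Num.Theory.
Import numFieldTopology.Exports numFieldNormedType.Exports.

Local Open Scope classical_set_scope.
Local Open Scope ring_scope.

Section Span.
Variables (K : nzRingType) (V : lmodType K).

Definition subspace_set (X : set V) : Prop :=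
  X 0 /\ forall (c : K) (x y : V), X x -> X y -> X (c *: x + y).

Definition lin_span (S : set V) : set V := smallest subspace_set S.

Lemma lin_span_subspace (S : set V) : subspace_set (lin_span S).
Proof.
split=> [X [[X0 _] _] //|c x y xS yS X XP].
by case: (XP) => -[_ XD] _; apply: XD; [exact: xS|exact: yS].
Qed.

Definition span_pred (S : set V) : {pred V} := mem (lin_span S).

Lemma span_pred_submod (S : set V) : submod_closed (span_pred S).
Proof.
have [S0 SD] := lin_span_subspace S.
by split=> [|c x y /set_mem xS /set_mem yS]; apply: mem_set => //; exact: SD.
Qed.

HB.instance Definition _ (S : set V) :=
  GRing.isSubmodClosed.Build K V (span_pred S) (span_pred_submod S).

End Span.

Section QuotientModule.
Local Open Scope quotient_scope.
Variables (K : nzRingType) (V : lmodType K) (S : set V).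
Local Notation N := (span_pred S).

(* V / span S *)
Definition lquot : Type := Quotient.quot N.
HB.instance Definition _ := GRing.Zmodule.on lquot.

Definition lquot_pi (x : V) : lquot := \pi_(Quotient.quot N) x.
Definition lquot_scale (c : K) (x : lquot) : lquot :=
  lquot_pi (c *: repr (x : Quotient.quot N)).

Lemma lquot_piP (x y : V) : x - y \in N -> lquot_pi x = lquot_pi y.
Proof. by move=> xyN; apply/eqP; rewrite /lquot_pi -Quotient.idealrBE. Qed.

Lemma lquot_repr (x : V) : x - repr (lquot_pi x : Quotient.quot N) \in N.
Proof. by rewrite Quotient.idealrBE reprK. Qed.

Lemma lquot_scale_pi (c : K) (x : V) :
  lquot_scale c (lquot_pi x) = lquot_pi (c *: x).
Proof.
apply/esym/lquot_piP; rewrite -scalerBr.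
by apply: rpredZ; exact: lquot_repr.
Qed.

Lemma lquot_piD (x y : V) : lquot_pi (x + y) = lquot_pi x + lquot_pi y.
Proof. exact: Quotient.pi_add. Qed.

Lemma lquot_piK (x : lquot) : exists y, x = lquot_pi y.
Proof. by exists (repr (x : Quotient.quot N)); rewrite /lquot_pi reprK. Qed.

Lemma lquot_scaleA (a b : K) (x : lquot) :
  lquot_scale a (lquot_scale b x) = lquot_scale (a * b) x.
Proof. by have [y ->] := lquot_piK x; rewrite !lquot_scale_pi scalerA. Qed.

Lemma lquot_scale1 : left_id 1 lquot_scale.
Proof. by move=> x; have [y ->] := lquot_piK x; rewrite lquot_scale_pi scale1r. Qed.

Lemma lquot_scaleDr : right_distributive lquot_scale +%R.
Proof.
move=> a x y; have [u ->] := lquot_piK x; have [v ->] := lquot_piK y.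
by rewrite -lquot_piD !lquot_scale_pi scalerDr lquot_piD.
Qed.

Lemma lquot_scaleDl (x : lquot) : {morph lquot_scale^~ x : a b / a + b}.
Proof.
move=> a b; have [u ->] := lquot_piK x.
by rewrite !lquot_scale_pi scalerDl lquot_piD.
Qed.

HB.instance Definition _ := GRing.Zmodule_isLmodule.Build K lquot
  lquot_scaleA lquot_scale1 lquot_scaleDr lquot_scaleDl.

End QuotientModule.

Section Tensor.
Variables (K : nzRingType) (U V : lmodType K).

Definition tensor_rel : set {freeg (U * V) / K} :=
  [set r | [\/ exists u u' v, r = << (u + u', v) >> - << (u, v) >> - << (u', v) >>,
              exists u v v', r = << (u, v + v') >> - << (u, v) >> - << (u, v') >>,
              exists c u v, r = << (c *: u, v) >> - c *: << (u, v) >> |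
              exists c u v, r = << (u, c *: v) >> - c *: << (u, v) >>]].

Definition tensor : Type := lquot tensor_rel.
HB.instance Definition _ := GRing.Lmodule.on tensor.

Definition pure_tensor (u : U) (v : V) : tensor :=
  lquot_pi tensor_rel << (u, v) >>.

End Tensor.

Arguments tensor {K} U V.

(* A locally C*-algebra need not have a unit, so the product is not a ring
   product of the library. *)
HB.mixin Record isStarAlgebra (R : realType) A & GRing.Lmodule R[i] A := {
  amul : A -> A -> A;
  star : A -> A;
  amulA : associative amul;
  amulDl : left_distributive amul +%R;
  amulDr : right_distributive amul +%R;
  amulZl : forall (c : R[i]) (a b : A), amul (c *: a) b = c *: amul a b;
  amulZr : forall (c : R[i]) (a b : A), amul a (c *: b) = c *: amul a b;
  starK : involutive star;
  starD : {morph star : a b / a + b};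
  starZ : forall (c : R[i]) (a : A), star (c *: a) = conjc c *: star a;
  starM : forall a b : A, star (amul a b) = amul (star b) (star a)
}.

#[short(type="starAlgType")]
HB.structure Definition StarAlgebra (R : realType) :=
  {A of GRing.Lmodule R[i] A & isStarAlgebra R A}.

#[short(type="preTopStarAlgType")]
HB.structure Definition PreTopologicalStarAlgebra (R : realType) :=
  {A of StarAlgebra R A & Topological A}.

Record cstar_seminorm (R : realType) (A : starAlgType R) (p : A -> R) : Prop := {
  cseminorm_ge0 : forall a, 0 <= p a;
  cseminormD : forall a b, p (a + b) <= p a + p b;
  cseminormZ : forall (c : R[i]) a, p (c *: a) = complex.Re `|c| * p a;
  cseminormM : forall a b, p (amul a b) <= p a * p b;
  cseminorm_cstar : forall a, p (amul (star a) a) = p a ^+ 2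
}.

(* S(A) *)
Definition cts_cstar_seminorms (R : realType) (A : preTopStarAlgType R) :
    set (A -> R) :=
  [set p | cstar_seminorm p /\ continuous p].

#[short(type="topStarAlgType")]
HB.structure Definition TopologicalStarAlgebra (R : realType) :=
  {A of StarAlgebra R A & TopologicalLmodule R[i] A}.

(* Cauchy filters and completeness are those of the topological group (A, +). *)
HB.mixin Record isLocallyCstar (R : realType) A
    & TopologicalStarAlgebra R A := {
  amul_continuous : continuous (fun x : A * A => amul x.1 x.2);
  star_continuous : continuous (star : A -> A);
  lcs_hausdorff : hausdorff_space A;
  lcs_complete : forall F : set_system A, ProperFilter F ->
    (forall U : set A, nbhs (0 : A) U ->
      exists2 X, F X & forall a b, X a -> X b -> U (a - b)) ->
    exists a : A, F --> a;
  lcs_cvg0P : forall F : set_system A, Filter F ->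
    (F --> (0 : A)) <->
    (forall p, @cts_cstar_seminorms R A p -> p x @[x --> F] --> (0 : R))
}.

#[short(type="locallyCstarType")]
HB.structure Definition LocallyCstar (R : realType) :=
  {A of TopologicalStarAlgebra R A & isLocallyCstar R A}.

(* In a locally C*-algebra the positive elements are those of the form b^* b. *)
Definition positive (R : realType) (A : starAlgType R) (a : A) : Prop :=
  exists b : A, a = amul (star b) b.

HB.mixin Record isPreHilbertModule (R : realType) (A : locallyCstarType R) E
    & GRing.Lmodule R[i] E := {
  ract : E -> A -> E;
  ip : E -> E -> A;
  ractDl : forall (x y : E) (a : A), ract (x + y) a = ract x a + ract y a;
  ractDr : forall (x : E) (a b : A), ract x (a + b) = ract x a + ract x b;
  ractA : forall (x : E) (a b : A), ract (ract x a) b = ract x (amul a b);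
  ractZl : forall (c : R[i]) (x : E) (a : A), ract (c *: x) a = c *: ract x a;
  ractZr : forall (c : R[i]) (x : E) (a : A), ract x (c *: a) = c *: ract x a;
  ipDr : forall x y z : E, ip x (y + z) = ip x y + ip x z;
  ipZr : forall (c : R[i]) (x y : E), ip x (c *: y) = c *: ip x y;
  ipMr : forall (x y : E) (a : A), ip x (ract y a) = amul (ip x y) a;
  ip_star : forall x y : E, star (ip x y) = ip y x;
  ip_positive : forall x : E, positive (ip x x);
  ip_eq0 : forall x : E, ip x x = 0 <-> x = 0
}.

#[short(type="preHilbertModType")]
HB.structure Definition PreHilbertModule (R : realType)
    (A : locallyCstarType R) :=
  {E of GRing.Lmodule R[i] E & isPreHilbertModule R A E}.

Definition mod_seminorm (R : realType) (A : locallyCstarType R)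
    (E : preHilbertModType A) (p : A -> R) (x : E) : R := Num.sqrt (p (ip x x)).

HB.mixin Record PreHilbertModule_isHilbert (R : realType)
    (A : locallyCstarType R) E & PreHilbertModule R A E := {
  hilbmod_complete : forall F : set_system E, ProperFilter F ->
    (forall p, @cts_cstar_seminorms R A p -> forall e : R, 0 < e ->
      exists2 X, F X & forall x y, X x -> X y -> mod_seminorm p (x - y) < e) ->
    exists x : E, forall p, @cts_cstar_seminorms R A p ->
      forall e : R, 0 < e -> F [set y | mod_seminorm p (y - x) < e]
}.

#[short(type="hilbertModType")]
HB.structure Definition HilbertModule (R : realType) (A : locallyCstarType R) :=
  {E of PreHilbertModule R A E & PreHilbertModule_isHilbert R A E}.

Section Ideal.
Variables (R : realType) (A : locallyCstarType R).

Definition ideal_set (X : set A) : Prop :=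
  [/\ subspace_set X, forall a x, X x -> X (amul a x)
    & forall x a, X x -> X (amul x a)].

Definition full (E : hilbertModType A) : Prop :=
  dense (smallest ideal_set [set a : A | exists x y : E, a = ip x y]).

End Ideal.

Definition selfmod (R : realType) (A : locallyCstarType R) : Type := A.
HB.instance Definition _ (R : realType) (A : locallyCstarType R) :=
  GRing.Lmodule.on (selfmod A).

Section SelfModule.
Variables (R : realType) (A : locallyCstarType R).
Implicit Types (a b c : A) (p : A -> R).

Definition self_ip a b : A := amul (star a) b.

Lemma cseminorm0 p : cstar_seminorm p -> p 0 = 0.
Proof. by move=> hp; rewrite -(scale0r 0) (cseminormZ hp) normr0 mul0r. Qed.

Lemma cseminormN p a : cstar_seminorm p -> p (- a) = p a.
Proof. by move=> hp; rewrite -scaleN1r (cseminormZ hp) normrN1 mul1r. Qed.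

Lemma cseminorm_eq0 a :
  (forall p, cts_cstar_seminorms p -> p a = 0) -> a = 0.
Proof.
move=> pa0; apply: lcs_hausdorff => U V Ua V0.
have Ca : globally [set a] --> (0 : A).
  have [_ +] := lcs_cvg0P _ (globally_filter [set a]); apply => p hp.
  move=> W /= W0 b ->.
  by rewrite /= (pa0 p hp); exact: nbhs_singleton W0.
by exists a; split; [exact: nbhs_singleton Ua|exact: Ca V0 a erefl].
Qed.

Lemma self_ip_star a b : star (self_ip a b) = self_ip b a.
Proof. by rewrite /self_ip starM starK. Qed.

Lemma self_ip_positive a : positive (self_ip a a).
Proof. by exists a. Qed.

Lemma amula0 a : amul a 0 = 0.
Proof. by rewrite -(scale0r (0 : A)) amulZr !scale0r. Qed.

Lemma self_ip_eq0 a : self_ip a a = 0 <-> a = 0.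
Proof.
split=> [aa0|->]; last exact: amula0.
apply: cseminorm_eq0 => p [hp _]; apply/eqP; rewrite -sqrf_eq0.
by rewrite -(cseminorm_cstar hp) -/(self_ip a a) aa0 (cseminorm0 hp).
Qed.

HB.instance Definition _ :=
  @isPreHilbertModule.Build R A (selfmod A) (@amul R A) self_ip
    (fun a b c => amulDl a b c) (fun a b c => amulDr a b c)
    (fun a b c => esym (amulA a b c)) (@amulZl R A) (@amulZr R A)
    (fun a b c => amulDr (star a) b c) (fun k a b => amulZr k (star a) b)
    (fun a b c => amulA (star a) b c) self_ip_star self_ip_positive self_ip_eq0.

Lemma self_seminorm p (a : selfmod A) :
  cstar_seminorm p -> mod_seminorm p a = p a.
Proof.
move=> hp; rewrite /mod_seminorm (cseminorm_cstar hp) sqrtr_sqr ger0_norm//.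
exact: cseminorm_ge0 hp a.
Qed.

Lemma nbhs0_seminorms (U : set A) : nbhs (0 : A) U ->
  exists2 s : seq ((A -> R) * R),
    {in s, forall q, cts_cstar_seminorms q.1 /\ 0 < q.2} &
    (forall a, {in s, forall q, q.1 a < q.2} -> U a).
Proof.
pose F : set_system A := [set X | exists2 s : seq ((A -> R) * R),
    {in s, forall q, cts_cstar_seminorms q.1 /\ 0 < q.2} &
    (forall a, {in s, forall q, q.1 a < q.2} -> X a)].
have FF : Filter F.
  split=> [|X Y [s hs sX] [t ht tY]|X Y XY [s hs sX]].
  - by exists [::].
  - exists (s ++ t) => [q|a sta].
      by rewrite mem_cat => /orP[/hs|/ht].
    by split; [apply: sX|apply: tY] => q qs; apply: sta; rewrite mem_cat qs ?orbT.
  - by exists s => // a /sX/XY.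
suff F0 : F --> (0 : A) by move=> /F0.
have [_ +] := lcs_cvg0P F FF; apply => p hp W /= [e /= e0 eW].
exists [:: (p, e)] => [q|a pa]; first by rewrite inE => /eqP ->.
apply: eW; rewrite /ball /= sub0r normrN ger0_norm; last first.
  by case: hp => hp _; exact: cseminorm_ge0 hp a.
by apply: (pa (p, e)); rewrite inE.
Qed.

Lemma selfmod_complete (F : set_system (selfmod A)) : ProperFilter F ->
  (forall p, cts_cstar_seminorms p -> forall e : R, 0 < e ->
    exists2 X, F X & forall x y, X x -> X y -> mod_seminorm p (x - y) < e) ->
  exists x : selfmod A, forall p, cts_cstar_seminorms p ->
    forall e : R, 0 < e -> F [set y | mod_seminorm p (y - x) < e].
Proof.
move=> FF FC; have [U U0|a Fa] := @lcs_complete R A F FF.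
  have [s hs sU] := nbhs0_seminorms U0.
  have [X FX XU] : exists2 X, F X & forall a b : selfmod A, X a -> X b ->
      {in s, forall q, q.1 (a - b) < q.2}.
    elim: s hs {sU} => [|q s IH] hs; first by exists setT => //; exact: filterT.
    have [X FX Xs] := IH (fun r rs => hs r (@mem_behead _ (q :: s) r rs)).
    have [hq q0] := hs q (mem_head _ _).
    have [Y FY Yq] := FC q.1 hq q.2 q0.
    exists (X `&` Y); first exact: filterI.
    move=> a b [Xa Ya] [Xb Yb] r; rewrite inE => /predU1P[->|]; last exact: Xs.
    by rewrite -self_seminorm; [exact: Yq|case: hq].
  by exists X => // a b Xa Xb; apply: sU; exact: XU.
exists a => p hp e e0; apply: Fa.
have sc : b - a @[b --> a] --> a - a.
  have ba : (b, a) @[b --> a] --> ((a, a) : A * A).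
    by apply: cvg_pair; [exact: cvg_id|exact: cvg_cst].
  exact: (cvg_comp _ _ ba (@sub_continuous A (a, a))).
have pc : p (b - a) @[b --> a] --> p (a - a).
  exact: (@cvg_comp _ _ _ (fun b : A => b - a) p _ _ _ sc (hp.2 _)).
have pe : nbhs (p (a - a)) [set t | t < e].
  by rewrite subrr (cseminorm0 hp.1); exact: lt_nbhsl.
apply: (@filterS A (nbhs a) _ _ _ _ (pc _ pe)) => b /= pba.
by rewrite self_seminorm//; exact: hp.1.
Qed.

HB.instance Definition _ :=
  @PreHilbertModule_isHilbert.Build R A (selfmod A) selfmod_complete.

End SelfModule.

(* An adjointable operator together with its (unique) adjoint. *)
Record adjointable (R : realType) (A : locallyCstarType R)
    (E F : hilbertModType A) := Adjointable {
  adj_fun :> E -> F;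
  adj_adj : F -> E;
  adj_linear : linear adj_fun;
  adj_adjP : forall x y, ip (adj_fun x) y = ip x (adj_adj y)
}.

Section PreHilbertTheory.
Variables (R : realType) (A : locallyCstarType R) (E : preHilbertModType A).
Implicit Types (x y z : E) (a : A).

Lemma star0 : star (0 : A) = 0.
Proof. by rewrite -(scale0r (0 : A)) starZ conjc0 !scale0r. Qed.

Lemma ip0r x : ip x 0 = 0.
Proof. by rewrite -(scale0r (0 : E)) ipZr scale0r. Qed.

Lemma ipNr x y : ip x (- y) = - ip x y.
Proof. by rewrite -scaleN1r ipZr scaleN1r. Qed.

Lemma ipBr x y z : ip x (y - z) = ip x y - ip x z.
Proof. by rewrite ipDr ipNr. Qed.

Lemma ipDl x y z : ip (x + y) z = ip x z + ip y z.
Proof. by rewrite -ip_star ipDr starD !ip_star. Qed.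

Lemma ipZl (c : R[i]) x y : ip (c *: x) y = conjc c *: ip x y.
Proof. by rewrite -ip_star ipZr starZ ip_star. Qed.

Lemma ip_injr y z : (forall x, ip x y = ip x z) -> y = z.
Proof.
move=> yz; apply/eqP; rewrite -subr_eq0; apply/eqP/ip_eq0.
by rewrite ipBr yz subrr.
Qed.

Lemma ipMl x y a : ip (ract x a) y = amul (star a) (ip x y).
Proof. by rewrite -ip_star ipMr starM ip_star. Qed.

End PreHilbertTheory.

Section AdjointableModule.
Variables (R : realType) (A : locallyCstarType R) (E F : hilbertModType A).
Implicit Types (T S : adjointable E F).

Lemma adjointable_eq T S : (forall x, T x = S x) -> T = S.
Proof.
case: T S => [f f' fl ff'] [g g' gl gg'] /= fg.
have {}fg : f = g by apply/funext.
have fg' : f' = g'.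
  by apply/funext => y; apply: ip_injr => x; rewrite -ff' -gg' fg.
by subst g g'; congr Adjointable; exact: Prop_irrelevance.
Qed.

Lemma adj_adj_linear T : linear (adj_adj T).
Proof.
move=> c y z; apply: ip_injr => x.
by rewrite -adj_adjP !ipDr !ipZr -!adj_adjP.
Qed.

Definition adj_zero : adjointable E F.
Proof.
refine (@Adjointable R A E F (fun=> 0) (fun=> 0) _ _).
  by move=> c x y; rewrite scaler0 addr0.
by move=> x y; rewrite ip0r -ip_star ip0r star0.
Defined.

Definition adj_opp T : adjointable E F.
Proof.
refine (@Adjointable R A E F (fun x => - T x) (fun y => - adj_adj T y) _ _).
  by move=> c x y; rewrite adj_linear opprD scalerN.
by move=> x y; rewrite ipNr -adj_adjP -scaleN1r ipZl rmorphN rmorph1 scaleN1r.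
Defined.

Definition adj_add T S : adjointable E F.
Proof.
refine (@Adjointable R A E F (fun x => T x + S x)
  (fun y => adj_adj T y + adj_adj S y) _ _).
  by move=> c x y; rewrite !adj_linear scalerDr addrACA.
by move=> x y; rewrite ipDl ipDr !adj_adjP.
Defined.

Definition adj_scale (c : R[i]) T : adjointable E F.
Proof.
refine (@Adjointable R A E F (fun x => c *: T x)
  (fun y => conjc c *: adj_adj T y) _ _).
  by move=> d x y; rewrite adj_linear scalerDr !scalerA mulrC.
by move=> x y; rewrite ipZl ipZr adj_adjP.
Defined.

HB.instance Definition _ := gen_eqMixin (adjointable E F).
HB.instance Definition _ := gen_choiceMixin (adjointable E F).

Lemma adj_addA : associative adj_add.
Proof. by move=> S T V; apply: adjointable_eq => x /=; rewrite addrA. Qed.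
Lemma adj_addC : commutative adj_add.
Proof. by move=> S T; apply: adjointable_eq => x /=; rewrite addrC. Qed.
Lemma adj_add0 : left_id adj_zero adj_add.
Proof. by move=> T; apply: adjointable_eq => x /=; rewrite add0r. Qed.
Lemma adj_addN : left_inverse adj_zero adj_opp adj_add.
Proof. by move=> T; apply: adjointable_eq => x /=; rewrite addNr. Qed.

HB.instance Definition _ := GRing.isZmodule.Build (adjointable E F)
  adj_addA adj_addC adj_add0 adj_addN.

Lemma adj_scaleA a b T : adj_scale a (adj_scale b T) = adj_scale (a * b) T.
Proof. by apply: adjointable_eq => x /=; rewrite scalerA. Qed.
Lemma adj_scale1 : left_id 1 adj_scale.
Proof. by move=> T; apply: adjointable_eq => x /=; rewrite scale1r. Qed.
Lemma adj_scaleDr : right_distributive adj_scale +%R.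
Proof. by move=> a S T; apply: adjointable_eq => x /=; rewrite scalerDr. Qed.
Lemma adj_scaleDl T : {morph adj_scale^~ T : a b / a + b}.
Proof. by move=> a b; apply: adjointable_eq => x /=; rewrite scalerDl. Qed.

HB.instance Definition _ := GRing.Zmodule_isLmodule.Build R[i]
  (adjointable E F) adj_scaleA adj_scale1 adj_scaleDr adj_scaleDl.

(* The seminorm of L_A(E,F) attached to p; extended-real valued because the
   finiteness of the supremum is a theorem. *)
Definition op_seminorm (p : A -> R) T : \bar R :=
  ereal_sup [set (mod_seminorm p (T x))%:E | x in [set x | mod_seminorm p x <= 1]].

(* Subbase of the topology of L_A(E,F): the open balls of the seminorms
   op_seminorm p, p in S(A). *)
Definition adj_subbase : set (set (adjointable E F)) :=
  [set O | exists p T (e : R), [/\ cts_cstar_seminorms p, 0 < e &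
     O = [set S : adjointable E F | (op_seminorm p (S - T)%R < e%:E)%E]]].

HB.instance Definition _ :=
  isSubBaseTopological.Build (adjointable E F) adj_subbase id.

Lemma theta_linear (y : F) (x : E) : linear (fun z => ract y (ip x z)).
Proof. by move=> c z w; rewrite ipDr ipZr ractDr ractZr. Qed.

Lemma theta_adjP (y : F) (x : E) (z : E) (w : F) :
  ip (ract y (ip x z)) w = ip z (ract x (ip y w)).
Proof. by rewrite ipMl ipMr ip_star. Qed.

Definition theta (y : F) (x : E) : adjointable E F :=
  Adjointable (theta_linear y x) (theta_adjP y x).

(* K_A(E,F) *)
Definition compacts : set (adjointable E F) :=
  closure (lin_span [set T | exists y x, T = theta y x]).

End AdjointableModule.

Section Composition.
Variables (R : realType) (A : locallyCstarType R) (E F G : hilbertModType A).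

Lemma adj_adj_adjP (T : adjointable E F) (y : F) (x : E) :
  ip (adj_adj T y) x = ip y (T x).
Proof. by rewrite -ip_star -adj_adjP ip_star. Qed.

Definition adjoint (T : adjointable E F) : adjointable F E :=
  Adjointable (adj_adj_linear T) (adj_adj_adjP T).

Lemma adj_comp_linear (T : adjointable F G) (S : adjointable E F) :
  linear (fun x => T (S x)).
Proof. by move=> c x y; rewrite !adj_linear. Qed.

Lemma adj_comp_adjP (T : adjointable F G) (S : adjointable E F) x y :
  ip (T (S x)) y = ip x (adj_adj S (adj_adj T y)).
Proof. by rewrite !adj_adjP. Qed.

Definition adj_comp (T : adjointable F G) (S : adjointable E F) :
  adjointable E G := Adjointable (adj_comp_linear T S) (adj_comp_adjP T S).

End Composition.

Arguments compacts {R A} E F.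

Record star_morphism_adj (R : realType) (A B : locallyCstarType R)
    (E : hilbertModType B) (Phi : A -> adjointable E E) : Prop := {
  smorph_adj_linear : linear Phi;
  smorph_adjM : forall a b, Phi (amul a b) = adj_comp (Phi a) (Phi b);
  smorph_adj_star : forall a, Phi (star a) = adjoint (Phi a);
  smorph_adj_continuous : continuous Phi
}.

(* Phi is an isomorphism of locally C*-algebras from A onto K_B(E); the
   topology of K_B(E) is the one induced by L_B(E). *)
Definition iso_onto_compacts (R : realType) (A B : locallyCstarType R)
    (E : hilbertModType B) (Phi : A -> adjointable E E) : Prop :=
  [/\ star_morphism_adj Phi, range Phi = compacts E E &
      exists2 Phi_inv : adjointable E E -> A, cancel Phi Phi_inv &
        {within compacts E E, continuous Phi_inv}].

Definition gives_strong_morita (R : realType) (A B : locallyCstarType R)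
    (E : hilbertModType A) (Psi : B -> adjointable E E) : Prop :=
  full E /\ iso_onto_compacts Psi.

Definition strongly_morita_equivalent (R : realType)
    (A B : locallyCstarType R) : Prop :=
  exists (E : hilbertModType A) (Psi : B -> adjointable E E),
    gives_strong_morita Psi.

(* The Hilbert B-module Et is K_A(E,A), by means of the linear bijection J, with
   the right action T.b = T o Psi b and the inner product
   <T,S> = Psi^-1 (T^* o S). *)
Record is_dual_module (R : realType) (A B : locallyCstarType R)
    (E : hilbertModType A) (Psi : B -> adjointable E E)
    (Et : hilbertModType B) (J : Et -> adjointable E (selfmod A)) : Prop := {
  dual_linear : linear J;
  dual_inj : injective J;
  dual_range : range J = compacts E (selfmod A);
  dual_ract : forall t b, J (ract t b) = adj_comp (J t) (Psi b);
  dual_ip : forall t s, Psi (ip t s) = adj_comp (adjoint (J t)) (J s)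
}.

(* The isomorphism alpha : A -> K(Et) with
   alpha(a)(theta_{b,x}) = theta_{ab,x}. *)
Definition is_dual_action (R : realType) (A B : locallyCstarType R)
    (E : hilbertModType A) (Et : hilbertModType B)
    (J : Et -> adjointable E (selfmod A)) (alpha : A -> adjointable Et Et) :
    Prop :=
  iso_onto_compacts alpha /\
  forall (a b : A) (x : E) (t : Et), J t = theta (b : selfmod A) x ->
    J (alpha a t) = theta (amul a b : selfmod A) x.

HB.mixin Record hasInnerProduct (R : realType) H & NormedModule R[i] H := {
  hdot : H -> H -> R[i];
  hdotDr : forall x y z : H, hdot x (y + z) = hdot x y + hdot x z;
  hdotZr : forall (c : R[i]) (x y : H), hdot x (c *: y) = c * hdot x y;
  hdotC : forall x y : H, hdot y x = conjc (hdot x y);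
  hdot_norm : forall x : H, hdot x x = `|x| ^+ 2
}.

#[short(type="hilbertType")]
HB.structure Definition HilbertSpace (R : realType) :=
  {H of CompleteNormedModule R[i] H & hasInnerProduct R H}.

Record bounded_op (R : realType) (H : hilbertType R) := BoundedOp {
  bop_fun :> H -> H;
  bop_linear : linear bop_fun;
  bop_bounded : exists M : R[i], forall h, `|bop_fun h| <= M * `|h|
}.

Section BoundedOperators.
Variables (R : realType) (H : hilbertType R).

HB.instance Definition _ := gen_eqMixin (bounded_op H).
HB.instance Definition _ := gen_choiceMixin (bounded_op H).

Definition op_norm (f : H -> H) : \bar R :=
  ereal_sup [set (complex.Re `|f h|)%:E | h in [set h | `|h| <= 1]].

(* Subbase of the norm topology of L(H). *)
Definition bop_subbase : set (set (bounded_op H)) :=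
  [set O | exists (T : bounded_op H) (e : R), 0 < e /\
     O = [set S : bounded_op H | (op_norm (fun h => (S h - T h)%R) < e%:E)%E]].

HB.instance Definition _ :=
  isSubBaseTopological.Build (bounded_op H) bop_subbase id.

End BoundedOperators.

(* The multiplicativity and *-preservation are spelled out on vectors; the
   adjoint of phi(a) is the operator S with <phi(a)h, k> = <h, S k>. *)
Record representation (R : realType) (A : locallyCstarType R)
    (H : hilbertType R) := Representation {
  rep_fun :> A -> bounded_op H;
  rep_linear : forall (c : R[i]) a b h,
    rep_fun (c *: a + b) h = c *: rep_fun a h + rep_fun b h;
  repM : forall a b h, rep_fun (amul a b) h = rep_fun a (rep_fun b h);
  rep_star : forall a h k, hdot (rep_fun a h) k = hdot h (rep_fun (star a) k);
  rep_continuous : continuous rep_fun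
}.

Definition nondegenerate_rep (R : realType) (A : locallyCstarType R)
    (H : hilbertType R) (phi : representation A H) : Prop :=
  dense (lin_span [set k : H | exists a h, k = phi a h]).

Definition unitary (R : realType) (H K : hilbertType R) (U : H -> K) : Prop :=
  [/\ linear U, forall h k, hdot (U h) (U k) = hdot h k & range U = setT].

Definition unitarily_equivalent (R : realType) (A : locallyCstarType R)
    (H K : hilbertType R) (phi : representation A H) (psi : representation A K) :
    Prop :=
  exists2 U : H -> K, unitary U & forall a h, U (phi a h) = psi a (U h).

Definition sesquilinear (R : realType) (X : lmodType R[i])
    (s : X -> X -> R[i]) : Prop :=
  (forall (c : R[i]) x y z, s x (c *: y + z) = c * s x y + s x z) /\
  (forall (c : R[i]) x y z, s (c *: x + y) z = conjc c * s x z + s y z).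

(* The form <.,.>_0 on the algebraic tensor product of E and H. *)
Definition is_induced_form (R : realType) (B : locallyCstarType R)
    (E : hilbertModType B) (H : hilbertType R) (phi : representation B H)
    (s : tensor E H -> tensor E H -> R[i]) : Prop :=
  [/\ sesquilinear s, forall x, 0 <= s x x &
   forall x y h k, s (pure_tensor x h) (pure_tensor y k) = hdot h (phi (ip x y) k)].

(* K is, by means of q, the Hilbert space completion of the quotient of X by the
   vectors of zero length for s: the kernel of q consists of these vectors, and
   the isometry induced on the quotient has a dense range. *)
Definition is_hilbert_completion (R : realType) (X : lmodType R[i])
    (s : X -> X -> R[i]) (K : hilbertType R) (q : X -> K) : Prop :=
  [/\ linear q, forall x y, hdot (q x) (q y) = s x y & dense (range q)].

(* (psi, K) is the representation of A induced by (phi, H) via E, on which A acts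
   through Phi; psi a is the bounded operator induced by the map
   x (x) h |-> Phi(a)x (x) h. *)
Definition is_induced_rep (R : realType) (A B : locallyCstarType R)
    (E : hilbertModType B) (Phi : A -> adjointable E E)
    (H : hilbertType R) (phi : representation B H)
    (K : hilbertType R) (psi : representation A K) : Prop :=
  exists s q, [/\ is_induced_form phi s, is_hilbert_completion s q &
    forall a x h, psi a (q (pure_tensor x h)) = q (pure_tensor (Phi a x) h)].

(* Main.v *)
(* The unitary matches phi(t x) h with t (x) (x (x) h), for t in K_A(E,A) and x
   in E: the two families have the same Gram matrix because
   <x, t^* s y>_A = (t x)^* (s y), and families with equal Gram matrices and
   dense spans are exchanged by a unitary.  The vectors phi(t x) h span a dense
   subspace since K_A(E,A) contains the theta_{b,y}, E is full and phi is
   non-degenerate.  The unitary intertwines the actions of A because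
   (alpha(a) t) x = a (t x), which is read off the inner products of alpha(a) t
   with the theta_{b,y}, without approximating t by finite-rank operators. *)
Require Import Defs.
From mathcomp Require Import all_boot all_order all_algebra.
From mathcomp Require Import all_classical reals ereal topology normedtype.
From mathcomp Require Import complex freeg ring.

Set Implicit Arguments.
Unset Strict Implicit.
Unset Printing Implicit Defensive.

Import Order.TTheory GRing.Theory Num.Theory.
Import numFieldTopology.Exports numFieldNormedType.Exports.

Local Open Scope classical_set_scope.
Local Open Scope ring_scope.

(** * Linear spans and preimages of subspaces *)

Section LinearSpan.
Variables (K : nzRingType) (V W : lmodType K).

Lemma sub_lin_span (S : set V) : S `<=` lin_span S.
Proof. exact: sub_smallest. Qed.

Lemma lin_span_sub (S X : set V) :
  subspace_set X -> S `<=` X -> lin_span S `<=` X.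
Proof. exact: smallest_sub. Qed.

Lemma linear_fun0 (f : V -> W) : linear f -> f 0 = 0.
Proof. by move=> fl; have := fl (-1) 0 0; rewrite !scaleN1r !addNr. Qed.

Lemma subspace_preimage (f : V -> W) (X : set W) :
  linear f -> subspace_set X -> subspace_set (f @^-1` X).
Proof.
move=> fl [X0 XD]; split=> [|c x y /= fx fy]; first by rewrite /= linear_fun0.
by rewrite /= fl; exact: XD.
Qed.

End LinearSpan.

(** * Generation of the algebraic tensor product by pure tensors *)

Section Tensor.
Variables (K : nzRingType) (U V : lmodType K).

(** A class is represented by a finite formal combination of pairs, from which one term is split off
    at a time. *)
Lemma tensor_ind (X : set (tensor U V)) :
  subspace_set X -> (forall u v, X (pure_tensor u v)) -> forall t, X t.
Proof.
move=> Xs Xp t; have [r ->] := lquot_piK t.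
have pi0 : lquot_pi (tensor_rel (U := U) (V := V)) 0 = 0.
  have := lquot_scale_pi (tensor_rel (U := U) (V := V)) 0 0.
  by rewrite scale0r => <-; exact: scale0r.
elim/freeg_ind_dom0: r => [|k [u v] D _ _ XD]; first by rewrite pi0; case: Xs.
have -> : << k *g (u, v) >> = k *: (<< (u, v) >> : {freeg (U * V) / K}).
  by apply/eqP/freeg_eqP => z; rewrite coeff_fgscale !coeffU mul1r.
rewrite lquot_piD -lquot_scale_pi.
by case: Xs => _; apply => //; exact: Xp.
Qed.

Lemma pure_tensor_linear_r (u : U) :
  linear (pure_tensor u : V -> tensor U V).
Proof.
pose rel := tensor_rel (U := U) (V := V).
have relN r : rel r -> r \in span_pred rel.
  by move=> rr; apply: mem_set; exact: sub_lin_span.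
move=> c v v'.
have -> : pure_tensor u (c *: v + v') =
    pure_tensor u (c *: v) + pure_tensor u v'.
  rewrite /pure_tensor -lquot_piD; apply/lquot_piP/relN.
  by rewrite opprD addrA; constructor 2; exists u, (c *: v), v'.
congr (_ + _); transitivity (lquot_pi rel (c *: << (u, v) >>)).
  by apply/lquot_piP/relN; constructor 4; exists c, u, v.
exact/esym/lquot_scale_pi.
Qed.

End Tensor.

(** * Density, closed subspaces and bounded linear maps *)

Section Closures.

Lemma denseE (T : topologicalType) (S : set T) :
  dense S <-> closure S = setT.
Proof.
split=> [dS|cS O [x Ox] Oo].
  rewrite -subTset => x _; rewrite closureEonbhs => B O BS [Oo Ox].
  have [y [Oy Sy]] := dS O (ex_intro _ x Ox) Oo.
  by exists y; split => //; exact: BS.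
have Sx : closure S x by rewrite cS.
have [y [Sy Oy]] := Sx O (open_nbhs_nbhs (conj Oo Ox)).
by exists y.
Qed.

Lemma dense_subset (T : topologicalType) (S X : set T) :
  S `<=` X -> dense S -> dense X.
Proof.
by move=> SX /denseE dS; apply/denseE; rewrite -subTset -dS; exact: closureS.
Qed.

Lemma dense_sub_closed (T : topologicalType) (S X : set T) :
  dense S -> closed X -> S `<=` X -> X = setT.
Proof.
move=> /denseE dS cX SX; rewrite -subTset -dS ((closure_id X).1 cX).
exact: closureS.
Qed.

Lemma continuous_closure (T T' : topologicalType) (f : T -> T') (S : set T)
    (X : set T') :
  continuous f -> S `<=` f @^-1` X -> closure S `<=` f @^-1` closure X.
Proof.
move=> fc SX x Sx B /fc /Sx[y [Sy By]].
by exists (f y); split => //; exact: SX.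
Qed.

Lemma subspace_closure (K : numFieldType) (V : normedModType K) (X : set V) :
  subspace_set X -> subspace_set (closure X).
Proof.
move=> [X0 XD]; split; first exact: subset_closure.
move=> c x y Xx Xy.
have fc : continuous (fun p : V * V => c *: p.1 + p.2).
  move=> p; apply: cvgD; last exact: cvg_snd.
  by apply: cvgZ; [exact: cvg_cst|exact: cvg_fst].
have XX : X `*` X `<=` (fun p : V * V => c *: p.1 + p.2) @^-1` X.
  by move=> [a b] [Xa Xb]; exact: XD.
apply: (@continuous_closure _ _ _ _ _ fc XX (x, y)).
move=> B [[P Q] /= [/Xx[a [Xa Pa]] /Xy[b [Xb Qb]]] PQB].
by exists (a, b); split => //; exact: PQB.
Qed.

Variables (K : numFieldType) (V W : normedModType K).

Lemma bounded_linear_cts (f : V -> W) (M : K) :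
  linear f -> (forall x, `|f x| <= M * `|x|) -> continuous f.
Proof.
move=> fl fM x.
(* The constant [|M| + 1] is positive whatever [M] is, so it can be divided by. *)
have fM' y : `|f y| <= (`|M| + 1) * `|y|.
  have /ger0_norm : 0 <= M * `|y| by exact: le_trans (fM y).
  rewrite normrM normr_id mulrDl mul1r => My.
  by apply: le_trans (fM y) _; rewrite -My lerDl.
have M0 : 0 < `|M| + 1 by rewrite ltr_wpDl.
apply/cvgrPdist_lt => e e0; near=> y.
have -> : f x - f y = f (x - y) by rewrite addrC -scaleN1r -fl scaleN1r addrC.
apply: le_lt_trans (fM' _) _; rewrite -ltr_pdivlMl//.
by near: y; apply: cvgr_dist_lt => //; rewrite mulr_gt0// invr_gt0.
Unshelve. all: by end_near. Qed.

(** By continuity the preimage of [closure X] is a closed subspace; containing the total set [S], it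
    is everything. *)
Lemma closure_span_image (f : V -> W) (S : set V) (X : set W) :
  linear f -> continuous f -> dense (lin_span S) -> subspace_set X ->
  S `<=` f @^-1` (closure X) -> forall x, closure X (f x).
Proof.
move=> fl fc dS Xs SX x.
suff /seteqP[_ /(_ x I)] : f @^-1` (closure X) = setT by [].
apply: dense_sub_closed dS _ _.
  by apply: (continuous_closedP f).1 => //; exact: closed_closure.
apply: lin_span_sub SX; apply: subspace_preimage fl _.
exact: subspace_closure.
Qed.

End Closures.

Lemma pure_tensor_dense (C : numFieldType) (U V : lmodType C)
    (K : normedModType C) (q : tensor U V -> K) :
  linear q -> dense (range q) ->
  dense (lin_span [set k | exists u v, k = q (pure_tensor u v)]).
Proof.
move=> ql; apply: dense_subset => _ [t _ <-].
pose X := q @^-1` lin_span [set k | exists u v, k = q (pure_tensor u v)].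
apply: (@tensor_ind _ _ _ X) => [|u v].
  by apply: subspace_preimage => //; exact: lin_span_subspace.
by apply: sub_lin_span; exists u, v.
Qed.

Lemma closure_norm_eq (K : numFieldType) (V W : normedModType K)
    (X : set (V * W)) :
  (forall p, X p -> `|p.1| = `|p.2|) ->
  forall p, closure X p -> `|p.1| = `|p.2|.
Proof.
move=> Xn; pose d (p : V * W) : K := `|p.1| - `|p.2|.
have dc : continuous d.
  move=> q; apply: cvgB.
    by apply: cvg_norm; exact: cvg_fst.
  by apply: cvg_norm; exact: cvg_snd.
have X0 : X `<=` d @^-1` [set 0] by move=> q Xq; apply/eqP; rewrite subr_eq0 Xn.
have c0 : closed [set 0 : K].
  by apply: accessible_closed_set1; exact/hausdorff_accessible/norm_hausdorff.
move=> p /(continuous_closure dc X0).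
by rewrite -((closure_id _).1 c0) => /eqP; rewrite subr_eq0 => /eqP.
Qed.

(** * Unitaries from families with equal Gram matrices *)

Section HilbertUnitary.
Variable R : realType.

Lemma hdotDl (H : hilbertType R) (x y z : H) :
  hdot (x + y) z = hdot x z + hdot y z.
Proof. by rewrite hdotC hdotDr rmorphD /= [hdot x z]hdotC [hdot y z]hdotC. Qed.

Lemma hdotZl (H : hilbertType R) (c : R[i]) (x y : H) :
  hdot (c *: x) y = conjc c * hdot x y.
Proof. by rewrite hdotC hdotZr rmorphM /= [hdot x y]hdotC. Qed.

Lemma hdot_norm_eq (H K : hilbertType R) (x : H) (y : K) :
  hdot x x = hdot y y -> `|x| = `|y|.
Proof. by rewrite !hdot_norm => /eqP; rewrite eqrXn2 ?normr_ge0// => /eqP. Qed.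

Lemma bounded_op_cts (H : hilbertType R) (T : bounded_op H) : continuous T.
Proof.
by have [M TM] := bop_bounded T; exact: bounded_linear_cts (bop_linear T) TM.
Qed.

Section Graph.
Variables (H K : hilbertType R) (I : Type) (f : I -> H) (g : I -> K).

(** The correspondence of [f i] with [g i] is kept as a relation, since a linear relation among the
    [f i] might a priori fail for the [g i]. *)
Definition span_graph : set (H * K) := lin_span (range (fun i => (f i, g i))).

Hypothesis gram_eq : forall i j, hdot (f i) (f j) = hdot (g i) (g j).

(** Equality of inner products against a fixed pair is a linear condition on the other pair, so it
    extends from generators to spans one argument at a time. *)
Lemma span_graph_hdot p q :
  span_graph p -> span_graph q -> hdot p.1 q.1 = hdot p.2 q.2.
Proof.
have sl (x : H * K) :
    subspace_set [set y : H * K | hdot x.1 y.1 = hdot x.2 y.2].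
  split=> [|c y z /= xy xz]; last by rewrite !hdotDr !hdotZr xy xz.
  by rewrite /= -(scale0r (0 : H)) -(scale0r (0 : K)) !hdotZr !mul0r.
move=> /(lin_span_sub _) Dp /(lin_span_sub _) Dq.
apply: (Dq _ (sl p)) => _ [j _ <-] /=.
have Xs : subspace_set [set p : H * K | hdot (f j) p.1 = hdot (g j) p.2].
  exact: (sl (f j, g j)).
rewrite hdotC [RHS]hdotC; congr conjc; apply: (Dp _ Xs) => _ [i _ <-].
exact: gram_eq.
Qed.

Lemma span_graph_norm p : closure span_graph p -> `|p.1| = `|p.2|.
Proof.
apply: closure_norm_eq => q Dq.
by apply: hdot_norm_eq; exact: span_graph_hdot.
Qed.

Hypothesis f_dense : dense (lin_span (range f)).

(** The partner [k] is the limit of the second coordinates of graph points whose first coordinates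
    tend to [h]; equality of norms on the graph makes them Cauchy, and [K] is complete. *)
Lemma span_graph_total (h : H) : exists k, closure span_graph (h, k).
Proof.
have Ds : subspace_set span_graph by exact: lin_span_subspace.
have approx U : nbhs h U -> exists2 p, span_graph p & U p.1.
  have : closure (lin_span (range f)) h by rewrite ((denseE _).1 f_dense).
  move=> /[apply] -[x [+ Ux]]; suff /[apply] : lin_span (range f) `<=`
      [set x | exists2 p, span_graph p & x = p.1].
    by move=> [p Dp xp]; exists p => //; rewrite -xp.
  apply: lin_span_sub => [|_ [i _ <-]]; last first.
    by exists (f i, g i) => //; apply: sub_lin_span; exists i.
  split=> [|c _ _ [p Dp ->] [q Dq ->]]; first by exists 0 => //; case: Ds.
  by exists (c *: p + q) => //; case: Ds => _; exact.
pose F : set_system K :=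
  [set X | exists2 U, nbhs h U & forall p, span_graph p -> U p.1 -> X p.2].
have FF : ProperFilter F.
  split=> [[U /approx[p Dp Up] /(_ p Dp Up)]//|].
  split=> [|X Y [U Uh UX] [V Vh VY]|X Y XY [U Uh UX]].
  - by exists setT => //; exact: filterT.
  - exists (U `&` V); first exact: filterI.
    by move=> p Dp [Up Vp]; split; [exact: UX|exact: VY].
  - by exists U => // p Dp Up; apply/XY/UX.
have /cauchy_cvg Fc : cauchy F.
  apply/cauchyP => e e0.
  have e20 : 0 < e / 2 by rewrite divr_gt0.
  have [p Dp hp] := approx _ (nbhsx_ballx h _ e20).
  exists p.2, (ball h (e / 2)); first exact: nbhsx_ballx.
  move=> q Dq hq; rewrite -ball_normE /=.
  have -> : `|p.2 - q.2| = `|p.1 - q.1|.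
    apply/esym/(@span_graph_norm (p - q))/subset_closure.
    by rewrite addrC -scaleN1r; case: Ds => _; exact.
  move: hp hq; rewrite -!ball_normE /= => hp hq.
  by rewrite [e]splitr (le_lt_trans (ler_distD h _ _))// ltrD// distrC.
have [k Fk] := (cvg_ex F).1 Fc.
exists k => B [[P Q] /= [Ph Qk] PQB].
have [U Uh UQ] := Fk _ Qk.
have [p Dp [Up Pp]] := approx _ (filterI Uh Ph).
by exists p; split => //; apply: PQB; split => //=; exact: UQ.
Qed.

End Graph.

(** Only equality of norms is carried to the closure of the graph; polarization recovers the inner
    products. *)
Lemma subspace_isometry_hdot (H K : hilbertType R) (X : set (H * K)) p q :
  subspace_set X -> (forall r, X r -> `|r.1| = `|r.2|) -> X p -> X q ->
  hdot p.1 q.1 = hdot p.2 q.2.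
Proof.
move=> [_ XD] Xn Xp Xq; pose j : R[i] := (0 +i* 1)%C.
have jc : conjc j = - j by rewrite /j; simpc.
have j0 : j != 0 by rewrite eq_complex /= oner_eq0 andbF.
(* Expanding the squared norm of [c *: q + p] isolates the cross terms: [c = 1] gives the sum of the
   two inner products, [c = j] their difference. *)
have polar (c : R[i]) : conjc c * hdot q.1 p.1 + c * hdot p.1 q.1 =
                        conjc c * hdot q.2 p.2 + c * hdot p.2 q.2.
  have nD (L : hilbertType R) (x y : L) : `|c *: y + x| ^+ 2 =
      conjc c * hdot y x + c * hdot x y + (c * conjc c * `|y| ^+ 2 + `|x| ^+ 2).
    by rewrite -!hdot_norm !(hdotDl, hdotDr, hdotZl, hdotZr); ring.
  have := Xn _ (XD c q p Xq Xp) => /= /(congr1 (fun z => z ^+ 2)).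
  by rewrite !nD (Xn _ Xp) (Xn _ Xq) => /addIr.
have := polar 1; have := polar j; rewrite conjc1 jc !mul1r !mulNr => e1 e2.
have {}e1 : hdot p.1 q.1 - hdot q.1 p.1 = hdot p.2 q.2 - hdot q.2 p.2.
  by apply: (mulfI j0); rewrite !mulrBr addrC e1 addrC.
apply: (@mulfI _ 2); first by rewrite pnatr_eq0.
have -> : 2 * hdot p.1 q.1 = (hdot q.1 p.1 + hdot p.1 q.1) +
  (hdot p.1 q.1 - hdot q.1 p.1) by ring.
by rewrite e1 e2; ring.
Qed.

(* The closed span of the pairs (f i, g i) is the graph of the unitary. *)
Lemma gram_unitary (H K : hilbertType R) (I : Type) (f : I -> H) (g : I -> K) :
  (forall i j, hdot (f i) (f j) = hdot (g i) (g j)) ->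
  dense (lin_span (range f)) -> dense (lin_span (range g)) ->
  exists2 U : H -> K, unitary U &
    forall (T : bounded_op H) (S : bounded_op K),
      (forall i, exists2 j, T (f i) = f j & S (g i) = g j) ->
      forall h, U (T h) = S (U h).
Proof.
move=> fg df dg; pose G := closure (span_graph f g).
have Gs : subspace_set G by apply: subspace_closure; exact: lin_span_subspace.
have Gn p : G p -> `|p.1| = `|p.2| by exact: span_graph_norm.
have [U GU] := choice (span_graph_total fg df).
have Guniq h k : G (h, k) -> k = U h.
  (* The two norms agree on the subspace [G], so a point of [G] with first coordinate 0 vanishes. *)
  move=> Ghk; have Gd : G (0, k - U h).
    have -> : (0, k - U h) = -1 *: (h, U h) + (h, k).
      by congr (_, _); rewrite /= scaleN1r addrC ?subrr.
    by apply: Gs.2 => //; exact: GU.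
  by have := Gn _ Gd; rewrite /= normr0 => /esym/normr0_eq0/subr0_eq.
exists U; first split.
- by move=> c x y; apply/esym/Guniq; exact: (Gs.2 c _ _ (GU x) (GU y)).
- move=> h k; apply/esym.
  exact: (subspace_isometry_hdot Gs Gn (GU h) (GU k)).
(* Surjectivity is totality with [f] and [g] exchanged, followed by the swap of coordinates. *)
- rewrite -subTset => k _.
  have [h Gkh] := span_graph_total (fun i j => esym (fg i j)) dg k.
  exists h => //; apply/esym/Guniq.
  have sc : continuous (fun p : K * H => (p.2, p.1)).
    by move=> p; apply: cvg_pair; [exact: cvg_snd|exact: cvg_fst].
  apply: (@continuous_closure _ _ _ (span_graph g f) _ sc _ (k, h)) => //.
  apply: lin_span_sub => [|_ [i _ <-]]; last by apply: sub_lin_span; exists i.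
  by apply: subspace_preimage => //; exact: lin_span_subspace.
- move=> T S TS h; apply/esym/Guniq.
  (* The pair [(T, S)] sends generators of the graph to generators, hence preserves its closure by
     linearity and continuity. *)
  pose M (p : H * K) := (T p.1, S p.2).
  have Mc : continuous M.
    move=> p; apply: cvg_pair.
      by apply: (cvg_comp _ _ cvg_fst); exact: bounded_op_cts.
    by apply: (cvg_comp _ _ cvg_snd); exact: bounded_op_cts.
  apply: (@continuous_closure _ _ _ (span_graph f g) _ Mc _ (h, U h)) (GU h).
  apply: lin_span_sub => [|_ [i _ <-]].
    apply: subspace_preimage; last exact: lin_span_subspace.
    by move=> c x y; rewrite /M /= !bop_linear.
  have [j Tj Sj] := TS i; apply: sub_lin_span; exists j => //.
  by rewrite /M /= Tj Sj.
Qed.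

End HilbertUnitary.

(** * Pointwise continuity of representations and a total set of vectors *)

Section Representations.
Variables (R : realType) (A : locallyCstarType R).

Lemma op_norm_ball_open (H : hilbertType R) (T : bounded_op H) (e : R) :
  0 < e ->
  open [set S : bounded_op H | (op_norm (fun h => (S h - T h)%R) < e%:E)%E].
Proof.
move=> e0; set O := [set _ | _].
exists [set O]; last by rewrite bigcup_set1.
move=> _ ->; apply: (@finI_from1 _ _ (@bop_subbase R H) id O).
by exists T, e.
Qed.

Lemma rep_eval_continuous (H : hilbertType R) (phi : representation A H)
    (h : H) :
  continuous (fun a => phi a h).
Proof.
move=> a; apply/cvgrPdist_lt => e e0.
have n0 : 0 < `|h| + 1 by rewrite ltr_wpDl.
(* The radius lies in [R[i]], whereas the balls of [op_norm] have radii in [R]; being positive, it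
   equals its real part. *)
have dE : (complex.Re (e / (`|h| + 1)))%:C%C = e / (`|h| + 1).
  by apply: RRe_real; apply: ger0_real; apply: ltW; rewrite divr_gt0.
set d := complex.Re _ in dE.
have d0 : 0 < d by rewrite -ltcR dE divr_gt0.
have aO : (op_norm (fun k => (phi a k - phi a k)%R) < d%:E)%E.
  apply: (@le_lt_trans _ _ 0%E); last by rewrite lte_fin.
  by apply: ge_ereal_sup => _ [k _ <-]; rewrite subrr normr0.
have pa := @rep_continuous _ _ _ phi a _
  (open_nbhs_nbhs (conj (op_norm_ball_open (phi a) d0) aO)).
apply: (@filterS _ (nbhs a) _ _ _ _ pa) => b /= bd.
(* Scaling by [|h| + 1] puts [k] in the unit ball and also covers [h = 0]. *)
pose k := (`|h| + 1)^-1 *: h.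
have hk : h = (`|h| + 1) *: k by rewrite scalerA divff ?gt_eqF// scale1r.
have k1 : `|k| <= 1.
  by rewrite normrZ gtr0_norm ?invr_gt0// ler_pdivrMl// mulr1 lerDl.
have {}bd : `|phi b k - phi a k| < d%:C%C.
  have /ger0_real/RRe_real <- := normr_ge0 (phi b k - phi a k).
  rewrite ltcR -lte_fin; apply: le_lt_trans bd.
  by apply: ereal_sup_ubound; exists k.
have lZ (T : bounded_op H) (c : R[i]) x : T (c *: x) = c *: T x.
  by rewrite -[c *: x]addr0 bop_linear (linear_fun0 (bop_linear T)) addr0.
rewrite distrC hk !lZ -scalerBr normrZ gtr0_norm// -ltr_pdivlMl//.
by move: bd; rewrite dE mulrC /k !lZ.
Qed.

(** Fullness replaces [ip x y] by an arbitrary [a]; non-degeneracy is then used twice, for the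
    vectors [phi a h] and for the vectors [phi b k]. *)
Lemma rep_ip_dense (E : hilbertModType A) (H : hilbertType R)
    (phi : representation A H) :
  full E -> nondegenerate_rep phi ->
  dense (lin_span
    [set k | exists b (x y : E) h, k = phi (amul b (ip x y)) h]).
Proof.
set S := [set _ | _] => Ef phind.
have Ss := lin_span_subspace S.
have step1 b a h : closure (lin_span S) (phi (amul b a) h).
  have fc : continuous (fun a' => phi b (phi a' h)).
    move=> a'; apply: (cvg_comp _ _ (@rep_eval_continuous H phi h a')).
    exact: bounded_op_cts.
  rewrite repM; suff /seteqP[_ /(_ a I)] :
    (fun a' => phi b (phi a' h)) @^-1` closure (lin_span S) = setT by [].
  apply: dense_sub_closed Ef _ _.
    by apply: (continuous_closedP _).1 => //; exact: closed_closure.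
  (* Quantifying over all [b] and [h] makes this set a two-sided ideal: a left factor is absorbed
     into [b], a right factor into [h]. *)
  suff : smallest (@ideal_set R A) [set c : A | exists x y : E, c = ip x y]
      `<=` [set a' | forall b h, lin_span S (phi (amul b a') h)].
    move=> sub a' /sub Xa; apply: subset_closure.
    by rewrite /= -repM; exact: Xa.
  apply: smallest_sub => [|_ [x [y ->]] b' h']; last first.
    by apply: sub_lin_span; exists b', x, y, h'.
  split.
  - have Ps b' h' : subspace_set [set a' | lin_span S (phi (amul b' a') h')].
      apply: (subspace_preimage (f := fun a' => phi (amul b' a') h')) => //.
      by move=> c x y; rewrite amulDr amulZr rep_linear.
    split=> [b' h'|c x y Xx Xy b' h']; first by have [] := Ps b' h'.
    exact: (Ps b' h').2 c _ _ (Xx b' h') (Xy b' h').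
  - by move=> c x Xx b' h'; rewrite amulA; exact: Xx.
  - by move=> x c Xx b' h'; rewrite amulA repM; exact: Xx.
have step2 b k : closure (lin_span S) (phi b k).
  apply: closure_span_image (bop_linear (phi b)) _ phind Ss _ k.
    exact: bounded_op_cts.
  by move=> _ [a [h ->]]; rewrite /= -repM.
apply/denseE; apply: dense_sub_closed phind (@closed_closure _ _) _.
apply: lin_span_sub; first exact: subspace_closure.
by move=> _ [b [k ->]].
Qed.

End Representations.

(** * Total families in induced Hilbert spaces *)

Section TensorCompletion.
Variable R : realType.

(* The positive element <x,x> is some b^* b, so |x (x) h| = |phi(b) h|. *)
Lemma induced_pure_tensor_continuous (B : locallyCstarType R)
    (E : hilbertModType B) (H K : hilbertType R) (phi : representation B H)
    (s : tensor E H -> tensor E H -> R[i]) (q : tensor E H -> K) (x : E) :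
  is_induced_form phi s -> is_hilbert_completion s q ->
  continuous (fun h => q (pure_tensor x h)).
Proof.
move=> [_ _ sE] [ql qs _]; have [b xb] := ip_positive x.
have [M bM] := bop_bounded (phi b).
apply: (@bounded_linear_cts _ _ _ _ M) => [c h k|h].
  by rewrite pure_tensor_linear_r ql.
rewrite (le_trans _ (bM h))// le_eqVlt; apply/predU1P; left.
by apply: hdot_norm_eq; rewrite qs sE xb repM -[b in RHS]starK rep_star !starK.
Qed.

(** The images of the tensors of [t] with arbitrary [k] are total, and for fixed [t] continuity in
    [k] lets [k] range only over the total family of images under [q1] of pure tensors. *)
Lemma induced_triple_dense (A B : locallyCstarType R) (E : hilbertModType A)
    (F : hilbertModType B) (H K L : hilbertType R) (phi : representation B K)
    (q1 : tensor E H -> K) (s : tensor F K -> tensor F K -> R[i])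
    (q2 : tensor F K -> L) :
  linear q1 -> dense (range q1) ->
  is_induced_form phi s -> is_hilbert_completion s q2 ->
  dense (lin_span (range (fun i : F * E * H =>
    q2 (pure_tensor i.1.1 (q1 (pure_tensor i.1.2 i.2)))))).
Proof.
move=> q1l dq1 sP qP; have [q2l _ dq2] := qP.
set S := (X in lin_span X); have Ss := lin_span_subspace S.
apply/denseE; apply: dense_sub_closed (pure_tensor_dense q2l dq2) _ _.
  exact: closed_closure.
apply: lin_span_sub; first exact: subspace_closure.
move=> _ [t [k ->]].
pose f k := q2 (pure_tensor t k).
have fl : linear f by move=> c v v'; rewrite /f pure_tensor_linear_r q2l.
apply: (closure_span_image (f := f) fl _ (pure_tensor_dense q1l dq1) Ss).
  exact: induced_pure_tensor_continuous sP qP.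
move=> _ [x [h ->]]; apply: subset_closure.
exact: (@sub_lin_span _ _ S _ (ex_intro2 _ _ (t, x, h) I erefl)).
Qed.

End TensorCompletion.

(** * The action of [A] on the dual module *)

Section DualModule.
Variables (R : realType) (A B : locallyCstarType R) (E : hilbertModType A).

(** The elements [e] with [e a c = 0] for all [a] form an ideal containing the inner products, as
    [<x, y> a c = <x, (y a) c>]; it is dense by fullness, and continuity extends the vanishing to
    every [e]. *)
Lemma full_ract_eq0 (c : A) : full E -> (forall y : E, ract y c = 0) -> c = 0.
Proof.
move=> Ef yc.
have ac0 e a : amul e (amul a c) = 0.
  pose m e := amul e (amul a c).
  have mc : continuous m.
    move=> e'; apply: (@continuous_comp _ _ _ (fun e => (e, amul a c))
      (fun p : A * A => amul p.1 p.2)); last exact: amul_continuous.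
    by apply: cvg_pair; [exact: cvg_id|exact: cvg_cst].
  have c0 : closed [set 0 : A].
    by apply: accessible_closed_set1; exact/hausdorff_accessible/lcs_hausdorff.
  suff /seteqP[_ /(_ e I)] : m @^-1` [set 0] = setT by [].
  apply: dense_sub_closed Ef _ _; first exact: (continuous_closedP _).1.
  suff : smallest (@ideal_set R A) [set a0 : A | exists x y : E, a0 = ip x y]
      `<=` [set e | forall a, amul e (amul a c) = 0].
    by move=> sub e' /sub; exact.
  apply: smallest_sub => [|_ [x [y ->]] a']; last first.
    by rewrite -ipMr -ractA yc ip0r.
  split=> [|a' x Xx b|x a' Xx b].
  - split=> [a'|k x y Xx Xy a'].
      by rewrite /= -(scale0r (0 : A)) amulZl !scale0r.
    by rewrite amulDl amulZl Xx Xy scaler0 addr0.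
  - by rewrite -amulA Xx amula0.
  - by rewrite -amulA [amul a' _]amulA Xx.
(* For [d = c^* c], the product [d^* d] has the form [e a c] with [e = d] and [a = c^*]; hence [d]
   and then [c] vanish. *)
apply: (self_ip_eq0 c).1; apply: (self_ip_eq0 _).1.
by rewrite /self_ip starM starK; exact: ac0.
Qed.

Lemma dual_theta (Psi : B -> adjointable E E) (Et : hilbertModType B)
    (J : Et -> adjointable E (selfmod A)) (b : selfmod A) (x : E) :
  is_dual_module Psi J -> exists t, J t = theta b x.
Proof.
move=> JP; suff [t _ tE] : range J (theta b x) by exists t.
rewrite (dual_range JP); apply: subset_closure; apply: sub_lin_span.
by exists b, x.
Qed.

(** Let [d] be the difference of the two sides. Pairing with [s] such that [J s = theta b y] moves
    the action onto [s], where it is known explicitly; this yields [y b^* d = 0], and fullness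
    removes [y]. *)
Lemma dual_action_apply (Psi : B -> adjointable E E) (Et : hilbertModType B)
    (J : Et -> adjointable E (selfmod A)) (alpha : A -> adjointable Et Et) :
  full E -> is_dual_module Psi J -> is_dual_action J alpha ->
  forall a t x, J (alpha a t) x = amul a (J t x).
Proof.
move=> Ef JP [[[_ _ alphaS _] _ _] alphaJ] a t x.
(* Taking [b] to be the difference itself gives [d^* d = 0]. *)
suff bd0 b : amul (star b) (J (alpha a t) x - amul a (J t x)) = 0.
  by apply/eqP; rewrite -subr_eq0; apply/eqP/self_ip_eq0; exact: bd0.
apply: full_ract_eq0 => // y.
have [s sE] := dual_theta b y JP.
have := dual_ip JP s (alpha a t).
have -> : ip s (alpha a t) = ip (alpha (star a) s) t.
  by rewrite alphaS /= adj_adj_adjP.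
rewrite (dual_ip JP) (alphaJ _ _ _ _ sE) sE.
move=> /(congr1 (fun T => adj_fun T x)) /=.
rewrite -scaleN1r amulDr amulZr ractDr ractZr scaleN1r => e.
apply/eqP; rewrite subr_eq0; apply/eqP; rewrite -[LHS]e.
by rewrite [ip _ _]/(amul (star (amul (star a) b)) (J t x)) starM starK amulA.
Qed.

End DualModule.

Theorem theorem4p3 (R : realType) (A B : locallyCstarType R)
    (AB : strongly_morita_equivalent A B)
    (E : hilbertModType A) (Psi : B -> adjointable E E)
    (E_Psi : gives_strong_morita Psi)
    (Et : hilbertModType B) (J : Et -> adjointable E (selfmod A))
    (Et_J : is_dual_module Psi J)
    (alpha : A -> adjointable Et Et) (alpha_J : is_dual_action J alpha)
    (H : hilbertType R) (phi : representation A H)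
    (phi_nondeg : nondegenerate_rep phi)
    (EH : hilbertType R) (Ephi : representation B EH)
    (Ephi_induced : is_induced_rep Psi phi Ephi)
    (EtEH : hilbertType R) (EtEphi : representation A EtEH)
    (EtEphi_induced : is_induced_rep alpha Ephi EtEphi) :
  unitarily_equivalent phi EtEphi.
Proof.
have [Ef _] := E_Psi.
have [s1 [q1 [[_ _ s1E] [q1l q1s dq1] Ephi_q1]]] := Ephi_induced.
have [s2 [q2 [s2P q2P EtEphi_q2]]] := EtEphi_induced.
have [_ _ s2E] := s2P; have [_ q2s _] := q2P.
pose f (i : Et * E * H) := phi (J i.1.1 i.1.2) i.2.
pose g (i : Et * E * H) := q2 (pure_tensor i.1.1 (q1 (pure_tensor i.1.2 i.2))).
(* For [i = (t, x, h)] and [j = (s, y, k)], the right side becomes the inner product of [h] with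
   [phi ((J t x)^* (J s y)) k], by moving the adjoint of [J t] across [ip]. *)
have fg i j : hdot (f i) (f j) = hdot (g i) (g j).
  rewrite /g q2s s2E Ephi_q1 q1s s1E (dual_ip Et_J) /= -adj_adjP.
  rewrite [ip _ _]/(amul (star (J i.1.1 i.1.2)) (J j.1.1 j.1.2)).
  by rewrite repM -rep_star.
have df : dense (lin_span (range f)).
  apply: dense_subset (rep_ip_dense Ef phi_nondeg).
  apply: lin_span_sub; first exact: lin_span_subspace.
  move=> _ [b [x [y [h ->]]]]; apply: sub_lin_span.
  (* The product of [b] and [ip x y] is [theta b x] applied to [y]. *)
  have [t tE] := dual_theta b x Et_J.
  by exists (t, y, h) => //; rewrite /f /= tE.
have dg : dense (lin_span (range g)).
  exact: induced_triple_dense q1l dq1 s2P q2P.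
have [U Uu UP] := gram_unitary fg df dg; exists U => // a h.
(* Both actions of [a] amount to the same move on indices, from [t] to [alpha a t]. *)
apply: UP => -[[t x] k]; exists (alpha a t, x, k).
  by rewrite /f /= (dual_action_apply Ef Et_J alpha_J) repM.
by rewrite /g EtEphi_q2.
Qed.
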